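(* Let $R$ be a commutative ring with $\operatorname{char}(R) = 2$ and let $I$ be a (proper) radical ideal of $R$. Then $I$ is an sdf-absorbing ideal of $R$.
   Context: All rings are commutative with identity $1 \neq 0$. A proper ideal $I$ of a commutative ring $R$ is a square-difference factor absorbing ideal (sdf-absorbing ideal) of $R$ if whenever $a, b \in R$ are both nonzero and $a^2 - b^2 \in I$, then $a + b \in I$ or $a - b \in I$. *)

(* Defs.v *)
From mathcomp Require Import all_boot all_algebra.
From mathcomp Require Import boolp classical_sets.

Set Implicit Arguments.
Unset Strict Implicit.
Unset Printing Implicit Defensive.

Import GRing.Theory.

Local Open Scope ring_scope.

(* [idealr_closed] already includes [1 \notin I], i.e. properness.  It expects
   a boolean predicate; [[in I]] is the classical membership predicate of the
   set [I], so that ideals are not restricted to decidable ones. *)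
Definition is_proper_ideal (R : comNzRingType) (I : set R) : Prop :=
  idealr_closed [in I].

Definition sdf_absorbing (R : comNzRingType) (I : set R) : Prop :=
  is_proper_ideal I /\
  forall a b : R, a != 0 -> b != 0 -> a ^+ 2 - b ^+ 2 \in I ->
    a + b \in I \/ a - b \in I.

Definition ideal_radical (R : comNzRingType) (I : set R) : set R :=
  [set x | exists2 n : nat, (0 < n)%N & x ^+ n \in I]%classic.

Definition is_radical (R : comNzRingType) (I : set R) : Prop :=
  ideal_radical I = I.

(* Main.v *)
Require Import Defs.
From mathcomp Require Import all_boot all_algebra.
From mathcomp Require Import boolp classical_sets.

(** In characteristic 2 squaring is the Frobenius endomorphism, so
    [(a + b) ^+ 2 = a ^+ 2 + b ^+ 2 = a ^+ 2 - b ^+ 2].  An ideal containing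
    a difference of squares therefore contains the square of [a + b], and a
    radical ideal then contains [a + b] itself. *)

Local Open Scope ring_scope.

Lemma sqrrD_pchar2 (R : comNzRingType) (a b : R) :
  2%N \in [pchar R] -> (a + b) ^+ 2 = a ^+ 2 - b ^+ 2.
Proof.
move=> char2.
by rewrite (GRing.oppr_pchar2 char2) -!(GRing.pFrobenius_autE char2)
           GRing.rmorphD.
Qed.

Theorem theorem2p4 (R : comNzRingType) (I : set R) :
  2%N \in [pchar R] -> is_proper_ideal I -> is_radical I -> sdf_absorbing I.
Proof.
move=> char2 idealI radI; split=> // a b _ _ abI; left.
rewrite inE -radI; exists 2%N => //.
by rewrite sqrrD_pchar2.
Qed.
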